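(* Let $E$ be a directed graph, $R\subseteq E^0_{\mathrm{reg}}$, $N:E^1\to(1,\infty)$ a function, and $\beta\in[0,\infty)$. The map $W_{\mathrm{fin}}$ from $D^\beta_{\mathrm{fin}}$ to the set of $[0,1]$-valued functions on $E^0_{\beta\text{-reg}}\setminus R$ given by $$W_{\mathrm{fin}}(m)(v)=\frac{Z_v^a(\beta)}{1-Z_v^s(\beta)}\Bigl(m(v)-\sum_{e\in vE^1}N(e)^{-\beta}m(r(e))\Bigr),\qquad v\in E^0_{\beta\text{-reg}}\setminus R,$$ is a convex isomorphism onto $$\Bigl\{\epsilon:E^0_{\beta\text{-reg}}\setminus R\to[0,1]\Bigm|\sum_{v\in E^0_{\beta\text{-reg}}\setminus R}\epsilon(v)=1\Bigr\}.$$ The inverse of $W_{\mathrm{fin}}$ is the map $\epsilon\mapsto\sum_{v\in E^0_{\beta\text{-reg}}\setminus R}\epsilon(v)\,m^\beta_v$.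
   Context: **Graphs.** A directed graph $E=(E^0,E^1,s,r)$ consists of arbitrary (not necessarily countable) sets $E^0$ (vertices), $E^1$ (edges) and maps $s,r:E^1\to E^0$. A path of length $n\ge1$ is a sequence $e_1\cdots e_n$ of edges with $r(e_i)=s(e_{i+1})$; vertices are paths of length $0$. $E^*$ is the set of all finite paths; $s(u)=s(e_1)$, $r(u)=r(e_n)$ for $u=e_1\cdots e_n$, and $s(v)=r(v)=v$ for $v\in E^0$. $vE^1=\{e\in E^1:s(e)=v\}$; $E^0_{\mathrm{reg}}=\{v: vE^1\text{ finite and non-empty}\}$. For paths, $u'\le u$ means $u'$ is an initial segment of $u$ (the initial segment of length $0$ is $s(u)$), and $u'<u$ means $u'\le u$, $u'\ne u$. Sums of nonnegative terms over arbitrary index sets are suprema of finite partial sums, in $[0,\infty]$. **Path space.** $E^\infty$ is the set of infinite paths, $E^{\le\infty}=E^*\cup E^\infty$; $Z(u)=\{x\in E^{\le\infty}:u\le x\}$ for $u\in E^*$. $E^{\le\infty}$ has the topology generated by all $Z(u)$ and their complements, and $\partial_RE=E^\infty\cup\{u\in E^*:r(u)\notin R\}$ has the subspace topology. **Weights.** $N$ is extended to $E^*$ by $N(v)=1$ for $v\in E^0$ and $N(e_1\cdots e_n)=N(e_1)\cdots N(e_n)$. **$D^\beta$ and associated measures.** $D^\beta$ is the set of functions $m:E^0\to[0,1]$ with $\sum_{v\in E^0}m(v)=1$; $m(v)=\sum_{e\in vE^1}N(e)^{-\beta}m(r(e))$ for $v\in R$; and $m(v)\ge\sum_{e\in vE^1}N(e)^{-\beta}m(r(e))$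 for all $v\in E^0$. Each $m\in D^\beta$ has an associated measure: the unique regular Borel probability measure $\mu$ on $\partial_RE$ with $\mu(Z(v)\cap\partial_RE)=m(v)$ for all $v\in E^0$ and $\mu(eA)=N(e)^{-\beta}\mu(A)$ for all $e\in E^1$ and Borel $A\subseteq Z(r(e))\cap\partial_RE$, where $eA=\{ex:x\in A\}$. $D^\beta_{\mathrm{fin}}$ (functions of finite type) is the set of $m\in D^\beta$ with $\mu(E^*\cap\partial_RE)=1$. **Partition functions.** For $v,v'\in E^0$: $vE_s^*v=\{u\in E^*: s(u)=r(u)=v,\ u\ne v,\ r(u')\ne v\text{ for any }v<u'<u\}$; $E_a^*v=\{u\in E^*: r(u)=v,\ r(u')\ne v\text{ for any }u'<u\}$; $v'E_a^*v=\{u\in E_a^*v: s(u)=v'\}$; $Z_v^s(\beta)=\sum_{u\in vE_s^*v}N(u)^{-\beta}$; $Z_v^a(\beta)=\sum_{u\in E_a^*v}N(u)^{-\beta}$. $E^0_{\beta\text{-reg}}=\{v: Z_v^a(\beta)<\infty,\ Z_v^s(\beta)<1\}$. For $v$ with $Z_v^a(\beta)<\infty$ and $Z^s_v(\beta)\le1$, $m_v^\beta(v')=\sum_{u\in v'E_a^*v}N(u)^{-\beta}(Z_v^a(\beta))^{-1}$ for $v'\in E^0$. A convex isomorphism is a bijection preserving convex combinations. *)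

(* Defs.v *)
From HB Require Import structures.
From mathcomp Require Import all_boot all_order all_algebra.
From mathcomp Require Import all_classical all_reals all_analysis.

Set Implicit Arguments.
Unset Strict Implicit.
Unset Printing Implicit Defensive.

Import Order.TTheory GRing.Theory Num.Theory.

Local Open Scope classical_set_scope.
Local Open Scope ring_scope.

Record digraph := Digraph {
  vertex : choiceType;
  edge : choiceType;
  src : edge -> vertex;
  tgt : edge -> vertex }.

Section Paths.
Variable E : digraph.

Definition out (v : vertex E) : set (edge E) := [set e | src e = v].

Definition regular_vertices : set (vertex E) :=
  [set v | finite_set (out v) /\ out v !=set0].

Fixpoint chain (v : vertex E) (l : seq (edge E)) : bool :=
  if l is e :: l' then (src e == v) && chain (tgt e) l' else true.

(* A finite path is its source together with its list of edges, so that the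
   paths of length 0 are the vertices. *)
Definition finpath := {p : vertex E * seq (edge E) | chain p.1 p.2}.

Definition path_src (u : finpath) : vertex E := (val u).1.
Definition path_edges (u : finpath) : seq (edge E) := (val u).2.
Definition path_rng (u : finpath) : vertex E :=
  last (path_src u) (map (@tgt E) (path_edges u)).

Definition vpath (v : vertex E) : finpath := exist _ (v, [::]) isT.

Definition infpath :=
  {x : nat -> edge E | `[< forall i, tgt (x i) = src (x i.+1) >]}.

Definition path_space : Type := (finpath + infpath)%type.

HB.instance Definition _ := Choice.on path_space.

(* u is an initial segment of x *)
Definition initial (u : finpath) (x : path_space) : Prop :=
  match x with
  | inl w => path_src u = path_src w /\ prefix (path_edges u) (path_edges w)
  | inr y => path_src u = src (val y 0%N) /\
             path_edges u = mkseq (val y) (size (path_edges u))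
  end.

Definition path_le (u' u : finpath) : Prop := initial u' (inl u).
Definition path_lt (u' u : finpath) : Prop := path_le u' u /\ u' <> u.

Definition cylinder (u : finpath) : set path_space := [set x | initial u x].

Definition path_subbase : set (set path_space) :=
  [set A | exists u, A = cylinder u \/ A = ~` cylinder u].

HB.instance Definition _ :=
  @isSubBaseTopological.Build path_space (set path_space) path_subbase id.

(* is_cons e x y means y = ex *)
Definition is_cons (e : edge E) (x y : path_space) : Prop :=
  match x, y with
  | inl u, inl w =>
      tgt e = path_src u /\ path_src w = src e /\ path_edges w = e :: path_edges u
  | inr u, inr w =>
      val w 0%N = e /\ forall i, val w i.+1 = val u i
  | _, _ => False
  end.

Definition simple_loops (v : vertex E) : set finpath :=
  [set u | [/\ path_src u = v, path_rng u = v, u <> vpath v &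
    forall u', path_lt (vpath v) u' -> path_lt u' u -> path_rng u' <> v]].

Definition first_arrivals (v : vertex E) : set finpath :=
  [set u | path_rng u = v /\ forall u', path_lt u' u -> path_rng u' <> v].

Definition first_arrivals_from (v' v : vertex E) : set finpath :=
  [set u | first_arrivals v u /\ path_src u = v'].

End Paths.

Section Boundary.
Variables (E : digraph) (R : set (vertex E)).

Definition boundary : set (path_space E) :=
  [set x | if x is inl u then ~ R (path_rng u) else True].

(* The library only puts sigma-algebras on pointed types, whereas the boundary
   may be empty: [pboundary x0] is the boundary, pointed at x0. *)
Definition pboundary (x0 : boundary) : Type := boundary.

HB.instance Definition _ (x0 : boundary) := Topological.on (pboundary x0).
HB.instance Definition _ (x0 : boundary) := isPointed.Build (pboundary x0) x0.

Definition borel_boundary (x0 : boundary) :=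
  g_sigma_algebraType (@open (pboundary x0)).

Definition bcylinder (u : finpath E) : set boundary :=
  [set x | cylinder u (val x)].

Definition finite_paths : set boundary :=
  [set x | exists u : finpath E, val x = inl u].

(* The set eA *)
Definition cons_set (e : edge E) (A : set boundary) : set boundary :=
  [set y | exists2 x, A x & is_cons e (val x) (val y)].

End Boundary.

Arguments bcylinder {E} R u.
Arguments finite_paths {E} R.

Section Measures.
Variables (K : realType) (E : digraph) (R : set (vertex E)).
Variables (N : edge E -> K) (beta : K).

Local Notation wt e := (N e `^ (- beta)).

Definition out_sum (m : vertex E -> K) (v : vertex E) : \bar K :=
  \esum_(e in out v) (wt e * m (tgt e))%:E.

Definition D_beta : set (vertex E -> K) :=
  [set m | [/\ forall v, 0 <= m v <= 1,
               \esum_(v in [set: vertex E]) (m v)%:E = 1%E,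
               forall v, R v -> (m v)%:E = out_sum m v &
               forall v, (out_sum m v <= (m v)%:E)%E]].

(* Finiteness on compact sets is automatic for a probability measure. *)
Definition regular_measure (x0 : boundary R)
    (mu : probability (borel_boundary x0) K) : Prop :=
  (forall A : set (borel_boundary x0), measurable A ->
    mu A = ereal_inf [set mu U | U in
      [set U : set (pboundary x0) | open U /\ A `<=` U]]) /\
  (forall U : set (pboundary x0), open U ->
    mu U = ereal_sup [set mu C | C in
      [set C : set (pboundary x0) | compact C /\ C `<=` U]]).

Definition associated_measure (m : vertex E -> K) (x0 : boundary R)
    (mu : probability (borel_boundary x0) K) : Prop :=
  [/\ regular_measure mu,
      forall v, mu (bcylinder R (vpath v)) = (m v)%:E &
      forall e (A : set (borel_boundary x0)), measurable A ->
        A `<=` bcylinder R (vpath (tgt e)) ->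
        mu (cons_set e A) = ((wt e)%:E * mu A)%E].

(* The associated measure of m is unique, so "some" and "the" agree here. *)
Definition D_fin : set (vertex E -> K) :=
  [set m | D_beta m /\
    exists (x0 : boundary R) (mu : probability (borel_boundary x0) K),
      associated_measure m mu /\ mu (finite_paths R) = 1%E].

Definition path_weight (u : finpath E) : K := \prod_(e <- path_edges u) N e.

Definition Z_s (v : vertex E) : \bar K :=
  \esum_(u in simple_loops v) (path_weight u `^ (- beta))%:E.

Definition Z_a (v : vertex E) : \bar K :=
  \esum_(u in first_arrivals v) (path_weight u `^ (- beta))%:E.

Definition beta_regular : set (vertex E) :=
  [set v | (Z_a v < +oo)%E /\ (Z_s v < 1)%E].

Definition m_beta (v v' : vertex E) : K :=
  fine (\esum_(u in first_arrivals_from v' v) (path_weight u `^ (- beta))%:E)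
  * (fine (Z_a v))^-1.

Definition W_fin (m : vertex E -> K) : beta_regular `\` R -> K :=
  fun v => fine (Z_a (val v)) / (1 - fine (Z_s (val v)))
           * (m (val v) - fine (out_sum m (val v))).

Definition simplex : set (beta_regular `\` R -> K) :=
  [set eps | (forall v, 0 <= eps v <= 1) /\
             \esum_(v in [set: beta_regular `\` R]) (eps v)%:E = 1%E].

Definition mixture (eps : beta_regular `\` R -> K) (v' : vertex E) : \bar K :=
  \esum_(v in [set: beta_regular `\` R]) (eps v * m_beta (val v) v')%:E.

End Measures.

Arguments D_fin {K E} R N beta.
Arguments W_fin {K E} R N beta m.
Arguments simplex {K E} R N beta.
Arguments mixture {K E} R N beta eps v'.

Definition convex_comb (K : realType) (X : Type) (t : K) (f g : X -> K) : X -> K :=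
  fun x => t * f x + (1 - t) * g x.

Definition convex_isomorphism (K : realType) (X Y : Type)
    (A : set (X -> K)) (B : set (Y -> K)) (W : (X -> K) -> (Y -> K)) : Prop :=
  set_bij A B W /\
  forall t f g, 0 <= t <= 1 -> A f -> A g ->
    A (convex_comb t f g) /\
    W (convex_comb t f g) = convex_comb t (W f) (W g).

(* Main.v *)
(* The weight of all paths from v to u is P(v,u) = F(v,u) P(u,u), where F only
   counts paths that arrive at u for the first time, and P(u,u) satisfies the
   renewal equation P(u,u) = 1 + Z_s(u) P(u,u); hence P(u,u) = 1 / (1 - Z_s(u))
   when Z_s(u) < 1.  These identities, and the bound for m below, follow from
   one minimality principle: a sum over paths is the least nonnegative
   supersolution of its one-step recursion.  If
   eps(u) = Z_a(u) / (1 - Z_s(u)) d(u), then the mixture of eps at v is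
   G(v) = sum_u d(u) P(v,u), the weight of all paths from v with d at the end,
   and the total mass of eps is sum_v G(v).

   Given eps, the discrete measure with mass N(w)^{-beta} d(r(w)) at each finite
   path w is associated with G.  Conversely, let m be of finite type and let d
   be its defect m - sum_e N(e)^{-beta} m(r(e)).  Minimality gives G <= m, and
   iterating the definition of d gives m(v) <= G(v) + mu(B_n), where B_n is the
   set of paths from v of length at least n; since mu lives on finite paths,
   mu(B_n) tends to 0. *)

From HB Require Import structures.
Require Import Defs.
From mathcomp Require Import all_boot all_order all_algebra.
From mathcomp Require Import all_classical all_reals all_analysis.
From mathcomp Require Import finmap ring lra.

Set Implicit Arguments.
Unset Strict Implicit.
Unset Printing Implicit Defensive.

Import Order.TTheory GRing.Theory Num.Theory.

Local Open Scope classical_set_scope.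
Local Open Scope ring_scope.

(** * Unordered sums *)

Section UnorderedSums.
Variable K : realType.
Local Open Scope ereal_scope.

Lemma esumZl (T : choiceType) (S : set T) (c : K) (f : T -> \bar K) :
  (0 <= c)%R -> (forall i, 0 <= f i) ->
  \esum_(i in S) (c%:E * f i) = c%:E * \esum_(i in S) f i.
Proof.
rewrite le_eqVlt => /predU1P[<- f0|c0 f0].
  by rewrite mul0e; apply: esum1 => i _; rewrite mul0e.
(* One inequality for all positive factors suffices: applied to c and to its inverse, it gives both
   directions. *)
have le_Z (k : K) (g : T -> \bar K) : (0 < k)%R -> (forall i, 0 <= g i) ->
    \esum_(i in S) (k%:E * g i) <= k%:E * \esum_(i in S) g i.
  move=> k0 g0; apply: ge_ereal_sup => _ [X XS <-].
  rewrite -ge0_mule_fsumr// lee_pmul2l ?fin_num_fun//.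
  by apply: ereal_sup_ubound; exists X.
apply/eqP; rewrite eq_le le_Z//= -lee_pdivlMl//.
apply: le_trans (le_Z _ _ _ _); rewrite ?invr_gt0//.
  by apply: le_esum => i _; rewrite muleA -EFinM mulVf ?gt_eqF// mul1e.
by move=> i; rewrite mule_ge0// lee_fin ltW.
Qed.

Lemma exchange_esum (T1 T2 : choiceType) (I : set T1) (J : set T2)
    (a : T1 -> T2 -> \bar K) : (forall i j, 0 <= a i j) ->
  \esum_(i in I) \esum_(j in J) a i j = \esum_(j in J) \esum_(i in I) a i j.
Proof.
move=> a0; rewrite !esum_esum//.
apply: (@reindex_esum _ _ _ _ _ (fun x : T2 * T1 => (x.2, x.1))
          (fun x => a x.1 x.2)).
split=> [[i j] []//|[i j] [i' j'] _ _ [-> ->]//|[i j] [Ii Jj]].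
by exists (j, i).
Qed.

Lemma esum_indic1 (T : choiceType) (x : T) (a : T -> \bar K) :
  0 <= a x -> \esum_(y in setT) ((x == y)%:R%:E * a y) = a x.
Proof.
move=> ax0; rewrite -[RHS](@esum_set1 _ _ x a)// [RHS]esum_mkcond.
apply: eq_esum => y _; case: eqVneq => [->|/eqP xy].
  by rewrite mul1e mem_set.
by rewrite mul0e memNset// => /esym.
Qed.

Lemma esum_fibres (T U : choiceType) (S : set T) (g : T -> U)
    (f : T -> \bar K) : (forall x, 0 <= f x) ->
  \esum_(x in S) f x = \esum_(y in setT) \esum_(x in S `&` g @^-1` [set y]) f x.
Proof.
move=> f0; rewrite esum_esum//; symmetry.
apply: (@reindex_esum _ _ _ _ _ (fun x => (g x, x)) (fun p => f p.2)).
split=> [x Sx//|x x' _ _ []//|[y x] [_ [Sx /= gx]]].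
by exists x; rewrite ?gx.
Qed.

Lemma esum_ge_term (T : choiceType) (S : set T) (f : T -> \bar K) x :
  (forall x, 0 <= f x) -> S x -> f x <= \esum_(y in S) f y.
Proof.
move=> f0 Sx; apply: esum_ge; exists [set x]; last by rewrite fsbig_set1.
by split=> // _ ->.
Qed.

(** A finite set has bounded size, so each finite partial sum is also a partial sum of some
    truncation. With [size] the length of a path, this opens path sums to induction on length. *)
Lemma esum_le_filtered (T : choiceType) (S : set T) (size : T -> nat)
    (f : T -> \bar K) (c : \bar K) :
  (forall n, \esum_(x in S) (if (size x <= n)%N then f x else 0) <= c) ->
  \esum_(x in S) f x <= c.
Proof.
move=> le_c; apply: ge_ereal_sup => _ [X [finX XS] <-].
have /finite_seqP[s Xs] := finX.
apply: le_trans (le_c (\max_(x <- s) size x)%N); apply: ereal_sup_ubound.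
exists X => //; apply: eq_fsbigr => x /set_mem; rewrite Xs /= => xs.
by rewrite (@leq_bigmax_seq _ s predT)//.
Qed.

Lemma esum_set_type (T : choiceType) (A : set T) (f : T -> \bar K) :
  \esum_(x in [set: A]) f (val x) = \esum_(x in A) f x.
Proof.
symmetry; apply: (@reindex_esum _ _ _ _ _ (fun x : A => val x)).
split=> [x _|x y _ _ /val_inj//|x Ax]; first exact: set_valP.
by exists (SigSub (mem_set Ax)).
Qed.

Lemma esum_subset (T : choiceType) (A B : set T) (f : T -> \bar K) :
  (forall x, 0 <= f x) -> A `<=` B ->
  \esum_(x in A) f x <= \esum_(x in B) f x.
Proof.
move=> f0 AB; apply: ge_ereal_sup => _ [X [finX XA] <-].
by apply: ereal_sup_ubound; exists X => //; split=> //; exact: subset_trans AB.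
Qed.

Lemma esum_support (T : choiceType) (A B : set T) (f : T -> \bar K) :
  A `<=` B -> (forall x, B x -> ~ A x -> f x = 0) ->
  \esum_(x in A) f x = \esum_(x in B) f x.
Proof.
move=> AB f0; rewrite esum_mkcond [RHS]esum_mkcond; apply: eq_esum => x _.
case: ifPn => [/set_mem/AB Bx|/negP nAx]; first by rewrite mem_set.
by case: ifPn => // /set_mem/f0 ->// Ax; apply: nAx; exact: mem_set.
Qed.

End UnorderedSums.

(** * Sums over paths *)

Section PathSums.
Variables (K : realType) (E : digraph).
Implicit Types (a : edge E -> K) (h : vertex E -> K) (v : vertex E).

Definition path_term a h v (l : seq (edge E)) : K :=
  \prod_(e <- l) a e * h (last v (map (@tgt E) l)).

(** With A the operator taking x to the function v -> sum of a(e) x(r(e)) over the edges e out of v,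
    this is the Neumann series of the A^n h. Indexing by edge lists with a fixed source makes
    splitting off the first edge structural. *)
Definition pathsum a h v : \bar K :=
  \esum_(l in [set l | chain v l]) (path_term a h v l)%:E.

Local Open Scope ereal_scope.

Lemma esum_chain (f : seq (edge E) -> \bar K) v : (forall l, 0 <= f l) ->
  \esum_(l in [set l | chain v l]) f l =
  f [::] + \esum_(e in out v) \esum_(l in [set l | chain (tgt e) l]) f (e :: l).
Proof.
move=> f0; rewrite (esumID [set [::]])//; congr (_ + _).
  rewrite -[RHS]esum_set1//; congr esum.
  by apply/seteqP; split=> [l [_]//|_ ->].
rewrite esum_esum//.
apply: (@reindex_esum _ _ _ _ _ (fun p => p.1 :: p.2) f).
split=> [[e l] [/= <- el]|[e l] [e' l'] _ _ /= [-> ->]//|[|e l]].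
- by split=> //=; rewrite eqxx.
- by case=> _ /(_ erefl).
- by case=> /= /andP[/eqP ev el] _; exists (e, l).
Qed.

Section Nonnegative.
Variables (a : edge E -> K) (h : vertex E -> K).
Hypotheses (a0 : forall e, (0 <= a e)%R) (h0 : forall v, (0 <= h v)%R).

Lemma path_term_ge0 v l : (0 <= path_term a h v l)%R.
Proof. by rewrite mulr_ge0// prodr_ge0. Qed.

Lemma pathsum_ge0 v : 0 <= pathsum a h v.
Proof. by apply: esum_ge0 => l _; rewrite lee_fin path_term_ge0. Qed.

Lemma path_term_cons v e l :
  path_term a h v (e :: l) = (a e * path_term a h (tgt e) l)%R.
Proof. by rewrite /path_term big_cons mulrA. Qed.

Lemma pathsum_rec v :
  pathsum a h v = (h v)%:E + \esum_(e in out v) ((a e)%:E * pathsum a h (tgt e)).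
Proof.
rewrite /pathsum esum_chain; last by move=> l; rewrite lee_fin path_term_ge0.
rewrite /path_term big_nil mul1r; congr (_ + _); apply: eq_esum => e _.
rewrite -esumZl//; last by move=> l; rewrite lee_fin path_term_ge0.
by apply: eq_esum => l _; rewrite -EFinM -(path_term_cons v).
Qed.

(** This is the minimality principle. The paths of length at most n contribute the n-th iterate of
    the monotone recursion, started from h; by induction on n, every supersolution dominates these
    iterates. *)
Lemma pathsum_le (x : vertex E -> \bar K) : (forall v, 0 <= x v) ->
  (forall v, (h v)%:E + \esum_(e in out v) ((a e)%:E * x (tgt e)) <= x v) ->
  forall v, pathsum a h v <= x v.
Proof.
move=> x0 hx v; apply: (@esum_le_filtered _ _ _ size) => n.
elim: n v => [|n IH] v.
  rewrite esum_chain => [|l]; last by case: ifP; rewrite ?lee_fin ?path_term_ge0.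
  rewrite /path_term big_nil mul1r (le_trans _ (hx v))// leeD2l//.
  rewrite (@esum1 _ _ (out v))=> [|e _]; last by rewrite esum1.
  by apply: esum_ge0 => e _; rewrite mule_ge0// lee_fin.
rewrite esum_chain => [|l]; last by case: ifP; rewrite ?lee_fin ?path_term_ge0.
rewrite /path_term big_nil mul1r (le_trans _ (hx v))// leeD2l//.
apply: le_esum => e _; apply: le_trans (lee_pmul _ _ (lexx _) (IH (tgt e))).
- rewrite -esumZl//; last first.
    by move=> l; case: ifP; rewrite ?lee_fin ?path_term_ge0.
  apply: le_esum => l _ /=; rewrite ltnS.
  by case: ifP; rewrite ?mule0// -EFinM -(path_term_cons v).
- by rewrite lee_fin.
- by apply: esum_ge0 => l _; case: ifP; rewrite ?lee_fin ?path_term_ge0.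
Qed.

End Nonnegative.
End PathSums.

(** * First arrivals and returns *)

Section FirstArrivals.
Variables (K : realType) (E : digraph) (a : edge E -> K).
Hypothesis a0 : forall e, 0 <= a e.
Implicit Types u v : vertex E.

(** The Green function P(v,u), with the end vertex u as first argument. *)
Definition visits u : vertex E -> \bar K := pathsum a (fun v => (u == v)%:R).

(** Killing the edges that leave u leaves weight only on paths that meet u at most at their end.
    Hence [arrivals u v] below is F(v,u). *)
Definition avoiding u (e : edge E) : K := if src e == u then 0 else a e.

Definition arrivals u : vertex E -> \bar K :=
  pathsum (avoiding u) (fun v => (u == v)%:R).

(** A first return to u is an edge out of u followed by a first arrival at u; this is Z_s(u), as
    [Z_sE] confirms. *)
Definition returns u : \bar K :=
  \esum_(e in out u) ((a e)%:E * arrivals u (tgt e))%E.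

Local Open Scope ereal_scope.

Lemma avoiding_ge0 u e : (0 <= avoiding u e)%R.
Proof. by rewrite /avoiding; case: ifP. Qed.

Lemma visits_ge0 u v : 0 <= visits u v.
Proof. exact: pathsum_ge0. Qed.

Lemma arrivals_ge0 u v : 0 <= arrivals u v.
Proof. by apply: pathsum_ge0 => // e; exact: avoiding_ge0. Qed.

Lemma returns_ge0 u : 0 <= returns u.
Proof. by apply: esum_ge0 => e _; rewrite mule_ge0 ?lee_fin ?arrivals_ge0. Qed.

Lemma arrivals_self u : arrivals u u = 1.
Proof.
rewrite /arrivals pathsum_rec//; last exact: avoiding_ge0.
rewrite eqxx esum1 ?adde0// => e /= eu.
by rewrite /avoiding eu eqxx mul0e.
Qed.

Lemma arrivals_rec u v : u != v ->
  arrivals u v = \esum_(e in out v) ((a e)%:E * arrivals u (tgt e)).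
Proof.
move=> uv; rewrite {1}/arrivals pathsum_rec//; last exact: avoiding_ge0.
rewrite (negbTE uv) add0e; apply: eq_esum => e /= ev.
by rewrite /avoiding ev eq_sym (negbTE uv).
Qed.

Lemma visits_rec u v : visits u v =
  (u == v)%:R%:E + \esum_(e in out v) ((a e)%:E * visits u (tgt e)).
Proof. exact: pathsum_rec. Qed.

Lemma visits_self_ge1 u : 1 <= visits u u.
Proof.
rewrite visits_rec eqxx leeDl//; apply: esum_ge0 => e _.
by rewrite mule_ge0 ?lee_fin ?visits_ge0.
Qed.

Lemma esum_out_Zl v (c : K) (x : vertex E -> \bar K) :
  (0 <= c)%R -> (forall v, 0 <= x v) ->
  \esum_(e in out v) ((a e)%:E * (c%:E * x (tgt e))) =
  c%:E * \esum_(e in out v) ((a e)%:E * x (tgt e)).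
Proof.
move=> c0 x0; rewrite -esumZl//; last by move=> e; rewrite mule_ge0 ?lee_fin.
by apply: eq_esum => e _; rewrite muleCA.
Qed.

(** The function c F(.,u) is a supersolution of the recursion of P(.,u): away from u both recursions
    agree, and at u the condition is the hypothesis on c. *)
Lemma visits_le u (c : K) : (0 <= c)%R -> 1 + c%:E * returns u <= c%:E ->
  forall v, visits u v <= c%:E * arrivals u v.
Proof.
move=> c0 hc; apply: pathsum_le => // [v|v].
  by rewrite mule_ge0 ?lee_fin ?arrivals_ge0.
rewrite esum_out_Zl//; last exact: arrivals_ge0.
case: eqVneq => [<-|uv]; first by rewrite arrivals_self mule1.
by rewrite add0e -arrivals_rec.
Qed.

(** Dually, P(.,u) / p is a supersolution of the recursion of F(.,u). At u the killed recursion only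
    asks for the value 1, which is why p has to be P(u,u). *)
Lemma visits_ge u (p : K) : visits u u = p%:E ->
  forall v, p%:E * arrivals u v <= visits u v.
Proof.
move=> up v; have p1 : (1 <= p)%R by rewrite -lee_fin -up visits_self_ge1.
have p0 : (0 < p)%R by exact: lt_le_trans p1.
rewrite -lee_pdivlMl// muleC -[X in _ <= X]muleC.
move: v; apply: pathsum_le => // [e|v|v]; first exact: avoiding_ge0.
  by rewrite mule_ge0 ?visits_ge0// lee_fin invr_ge0 ltW.
case: eqVneq => [<-|uv].
  rewrite esum1 => [|e /= eu]; last by rewrite /avoiding eu eqxx mul0e.
  by rewrite up -EFinM mulVf ?gt_eqF// adde0.
rewrite add0e visits_rec (negbTE uv) add0e -esum_out_Zl//; last first.
- exact: visits_ge0.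
- by rewrite invr_ge0 ltW.
by apply: le_esum => e /= ev; rewrite /avoiding ev eq_sym (negbTE uv).
Qed.

(** By [visits_ge], the recursion at u yields 1 + p Z_s(u) <= p, which is the hypothesis of
    [visits_le] for c = p. So P(.,u) = p F(.,u), and the recursion at u becomes the renewal
    equation. *)
Lemma visits_self_renewal u (p : K) : visits u u = p%:E ->
  visits u u = 1 + p%:E * returns u.
Proof.
move=> up; have p0 : (0 <= p)%R by rewrite -lee_fin -up visits_ge0.
have ge1 : 1 + p%:E * returns u <= visits u u.
  rewrite visits_rec eqxx leeD2l// /returns -esum_out_Zl//; last first.
    exact: arrivals_ge0.
  by apply: le_esum => e _; rewrite lee_pmul ?lee_fin ?mule_ge0 ?lee_fin
    ?arrivals_ge0 ?visits_ge.
have le1 := ge1; rewrite up in le1.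
have visitsE v : visits u v = p%:E * arrivals u v.
  by apply/eqP; rewrite eq_le visits_le// visits_ge.
rewrite {1}visits_rec eqxx /returns -esum_out_Zl//; last exact: arrivals_ge0.
by congr (_ + _); apply: eq_esum => e _; rewrite visitsE.
Qed.

(** With p finite and at least 1, the renewal equation p = 1 + p z forces p z < p. *)
Lemma returns_lt1 u : visits u u < +oo -> returns u < 1.
Proof.
move=> fu; have fin : visits u u \is a fin_num by rewrite ge0_fin_numE ?visits_ge0.
have up := esym (fineK fin); have := visits_self_renewal up.
have := visits_self_ge1 u; rewrite up; move: (fine _) => p; rewrite lee_fin => p1.
have p0 : (0 < p)%R by exact: lt_le_trans p1.
have := returns_ge0 u; case: (returns u) => [z|_|//].
  rewrite lee_fin lte_fin -EFinM -EFinD => z0 [pz].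
  by rewrite -(ltr_pM2l p0) mulr1 {2}pz ltrDr.
by rewrite gt0_muley ?lte_fin.
Qed.

Lemma visitsE u v : returns u < 1 ->
  visits u v = ((1 - fine (returns u))^-1)%:E * arrivals u v.
Proof.
move=> z1; have := returns_ge0 u.
have : returns u \is a fin_num.
  by rewrite ge0_fin_numE ?returns_ge0// (lt_trans z1)// ltry.
move: z1 (@visits_le u) (@visits_self_renewal u).
case: (returns u) => [z|//|//]; rewrite /= lte_fin lee_fin => z1 le_c renewal _ z0.
have s0 : (0 < 1 - z)%R by rewrite subr_gt0.
(* The constant c = 1 / (1 - z) solves 1 + c z = c. This bound makes P(u,u) finite, and only then
   does the renewal equation determine it. *)
have le_v w : visits u w <= ((1 - z)^-1)%:E * arrivals u w.
  apply: le_c; first by rewrite invr_ge0 ltW.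
  rewrite -EFinM -EFinD lee_fin -(ler_pM2l s0) mulrDr mulrA mulfV ?gt_eqF//.
  by rewrite mulr1 mul1r subrK.
have fin : visits u u \is a fin_num.
  rewrite ge0_fin_numE ?visits_ge0// (le_lt_trans (le_v u))//.
  by rewrite arrivals_self mule1 ltry.
have [p up] : exists p, visits u u = p%:E.
  by exists (fine (visits u u)); rewrite fineK.
have ge_v := visits_ge up v; have := renewal _ up.
rewrite up -EFinM -EFinD => -[pz].
have pE : (p = (1 - z)^-1)%R.
  apply: (mulfI (lt0r_neq0 s0)); rewrite mulfV ?gt_eqF// mulrBl mul1r.
  by apply/eqP; rewrite subr_eq [(z * p)%R]mulrC; apply/eqP.
by apply/eqP; rewrite eq_le le_v -pE.
Qed.

End FirstArrivals.

(** * The partition functions *)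

Section FinitePaths.
Variable E : digraph.
Implicit Types (u v : vertex E) (w : finpath E) (l : seq (edge E)).

Lemma chain_cat v l1 l2 :
  chain v (l1 ++ l2) = chain v l1 && chain (last v (map (@tgt E) l1)) l2.
Proof. by elim: l1 v => //= e l1 IH v; rewrite IH andbA. Qed.

Lemma path_ltP v l (vl : chain v l) w :
  path_lt w (exist _ (v, l) vl) <->
  [/\ path_src w = v & exists e l2, l = path_edges w ++ e :: l2].
Proof.
case: w => [[v' l'] vl'].
rewrite /path_lt /Defs.path_le /= /path_src /path_edges /=; split.
  move=> [[vv' /prefixP[[|e l2] ll2]] neq]; last by split=> //; exists e, l2.
  by case: neq; apply: val_inj => /=; rewrite ll2 cats0 vv'.
move=> [vv' [e [l2 ll2]]]; split; first by rewrite ll2 prefix_prefix.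
case=> _ /(congr1 size)/eqP.
by rewrite ll2 size_cat -[X in X == _]addn0 eqn_add2l.
Qed.

(** The proper initial segments of a path end at the sources of its edges, so avoiding u before the
    end is a condition on edges alone. *)
Lemma first_arrivalsP u v l (vl : chain v l) :
  first_arrivals u (exist _ (v, l) vl) <->
  (last v (map (@tgt E) l) == u) && all (fun e => src e != u) l.
Proof.
rewrite /first_arrivals /= /path_rng {1}/path_src {1}/path_edges /=; split.
  move=> [-> avoid]; rewrite eqxx /=; apply/allP => e el.
  case/path.splitPr: el vl avoid => l1 l2 vl avoid.
  have := vl; rewrite chain_cat => /andP[vl1] /= /andP[/eqP -> _].
  apply/eqP; apply: (avoid (exist _ (v, l1) vl1)).
  by apply/path_ltP; split=> //; exists e, l2.
move=> /andP[/eqP -> /allP avoid]; split=> // w /path_ltP[-> [e [l2 le]]].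
have := vl; rewrite le chain_cat => /andP[_] /= /andP[/eqP <- _].
by apply/eqP/avoid; rewrite le mem_cat mem_head orbT.
Qed.

(** The first edge is exempt from the avoidance condition because it starts at u. *)
Definition first_return u l : bool :=
  if l is e :: l' then
    (last u (map (@tgt E) l) == u) && all (fun e => src e != u) l'
  else false.

Lemma simple_loopsP u l (ul : chain u l) :
  simple_loops u (exist _ (u, l) ul) <->
  first_return u l.
Proof.
rewrite /simple_loops /= /path_rng !{1}/path_src {1}/path_edges /=; split.
  case: l ul => [ul [_ _ []]|e l ul [_ /= -> _ avoid]]; first exact: val_inj.
  rewrite eqxx /=; apply/allP => f fl.
  case/path.splitPr: fl ul avoid => l1 l2 ul avoid.
  have := ul; rewrite -cat_cons chain_cat => /andP[ul1] /= /andP[/eqP -> _].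
  apply/eqP; apply: (avoid (exist _ (u, e :: l1) ul1)); apply/path_ltP.
    by split=> //; exists e, l1.
  by split=> //; exists f, l2.
case: l ul => // e l ul /andP[/eqP -> /allP avoid]; split=> //.
move=> [[v' l'] vl'] + /path_ltP[+ [f [l2 le]]].
move=> /path_ltP[uv' [e' [l1]]]; rewrite /path_src /path_edges /= => l1e v'u.
rewrite /path_edges /= in le.
have := ul; rewrite le chain_cat v'u => /andP[_] /= /andP[/eqP <- _].
apply/eqP/avoid; move: le; rewrite l1e /= => -[_ ->].
by rewrite mem_cat mem_head orbT.
Qed.

End FinitePaths.

Section PartitionFunctions.
Variables (K : realType) (E : digraph) (N : edge E -> K) (beta : K).
Hypothesis N0 : forall e, 0 <= N e.

Local Notation wt := (fun e : edge E => N e `^ (- beta)).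

Lemma wt_ge0 e : 0 <= wt e.
Proof. exact: powR_ge0. Qed.

Lemma powR_path_weight (w : finpath E) :
  path_weight N w `^ (- beta) = \prod_(e <- path_edges w) wt e.
Proof.
rewrite /path_weight; elim: (path_edges w) => [|e l IH].
  by rewrite !big_nil powR1.
by rewrite !big_cons powRM ?IH// prodr_ge0.
Qed.

Lemma prod_avoiding u l : \prod_(e <- l) avoiding wt u e =
  if all (fun e => src e != u) l then \prod_(e <- l) wt e else 0.
Proof.
elim: l => [|e l IH]; first by rewrite !big_nil.
rewrite !big_cons IH /= /avoiding.
by case: eqVneq => _ /=; rewrite ?mul0r//; case: ifP; rewrite ?mulr0.
Qed.

Local Open Scope ereal_scope.

(** Passes from paths, which carry a proof of composability, to bare edge lists. Forgetting the
    source is injective on S, since S fixes it to be v. *)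
Lemma esum_paths_from v (S : set (finpath E)) (Q : pred (seq (edge E)))
    (f : seq (edge E) -> \bar K) :
  (forall w, S w <-> path_src w = v /\ Q (path_edges w)) ->
  \esum_(w in S) f (path_edges w) =
  \esum_(l in [set l | chain v l]) if Q l then f l else 0.
Proof.
move=> SQ.
have -> : \esum_(l in [set l | chain v l]) (if Q l then f l else 0) =
    \esum_(l in [set l | chain v l] `&` [set l | Q l]) f l.
  rewrite esum_mkcondr; apply: eq_esum => l _.
  case: ifPn => Ql; first by rewrite mem_set.
  by rewrite memNset//=; exact/negP.
symmetry; apply: (@reindex_esum _ _ _ _ _ (fun w => path_edges w)).
split=> [[[v' l] vl] /SQ[<- //]|[[v1 l1] vl1] [[v2 l2] vl2]|l [vl Ql]].
- move=> /set_mem/SQ[v1v _] /set_mem/SQ[v2v _] /= l12; apply: val_inj => /=.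
  by congr (_, _) => //; exact: etrans v1v (esym v2v).
- by exists (exist _ (v, l) vl) => //; apply/SQ.
Qed.

Lemma esum_first_arrivals_from u v :
  \esum_(w in first_arrivals_from v u) (path_weight N w `^ (- beta))%:E =
  arrivals wt u v.
Proof.
under eq_esum do rewrite powR_path_weight.
rewrite (@esum_paths_from v _
  (fun l => (last v (map (@tgt E) l) == u) && all (fun e => src e != u) l)
  (fun l => (\prod_(e <- l) wt e)%:E)).
  apply: eq_esum => l _; rewrite /path_term prod_avoiding eq_sym.
  by case: eqVneq => _ /=; rewrite ?mulr0// mulr1; case: ifP.
move=> [[v' l] vl]; rewrite /first_arrivals_from /=; split.
  by move=> [/first_arrivalsP fa <-].
rewrite {1}/path_src /= => -[vv' fa]; split=> //.
by apply/first_arrivalsP; rewrite vv'.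
Qed.

Lemma Z_aE u : Z_a N beta u = \esum_(v in setT) arrivals wt u v.
Proof.
rewrite /Z_a (@esum_fibres _ _ _ _ (@path_src E)); last first.
  by move=> w; rewrite lee_fin powR_ge0.
by apply: eq_esum => v _; rewrite -esum_first_arrivals_from.
Qed.

(** Splitting off the first edge of a loop leaves a first arrival at u. The empty list is no first
    return, so it adds 0. *)
Lemma Z_sE u : Z_s N beta u = returns wt u.
Proof.
rewrite /Z_s; under eq_esum do rewrite powR_path_weight.
rewrite (@esum_paths_from u _ (first_return u)
  (fun l => (\prod_(e <- l) wt e)%:E)).
  rewrite esum_chain/= ?add0e; last first.
    case=> [//|e l]; case: ifP => // _.
    by rewrite lee_fin prodr_ge0// => f _; exact: wt_ge0.
  apply: eq_esum => e _; rewrite -esumZl ?wt_ge0//; last first.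
    move=> l; rewrite lee_fin path_term_ge0// => f.
    exact: avoiding_ge0 wt_ge0 _ _.
  apply: eq_esum => l _; rewrite /path_term prod_avoiding big_cons eq_sym.
  rewrite -EFinM; case: eqVneq => _ /=; rewrite ?mulr0// mulr1.
  by case: ifP; rewrite ?mulr0.
move=> [[v l] vl]; split.
  move=> ls; have [+ _ _ _] := ls; rewrite /path_src /= => vu.
  by subst v; split=> //; exact: (iffLR (simple_loopsP _) ls).
by move=> [/= vu ls]; rewrite /path_src /= in vu; subst v; apply/simple_loopsP.
Qed.

(** Sorts the paths from v by their end u, by inserting the indicator of the end and exchanging the
    two sums. *)
Lemma pathsum_visits (d : vertex E -> K) v : (forall v, 0 <= d v)%R ->
  pathsum wt d v = \esum_(u in setT) ((d u)%:E * visits wt u v).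
Proof.
move=> d0.
have p0 l : (0 <= \prod_(e <- l) wt e)%R.
  by rewrite prodr_ge0// => e _; exact: wt_ge0.
transitivity (\esum_(u in setT) \esum_(l in [set l | chain v l])
    ((last v (map (@tgt E) l) == u)%:R%:E * (\prod_(e <- l) wt e * d u)%:E)).
  rewrite exchange_esum => [|u l]; last by rewrite mule_ge0// lee_fin ?mulr_ge0.
  by apply: eq_esum => l _; rewrite esum_indic1// lee_fin mulr_ge0.
apply: eq_esum => u _; rewrite -esumZl//; last first.
  by move=> l; rewrite lee_fin path_term_ge0//; exact: wt_ge0.
apply: eq_esum => l _; rewrite -!EFinM /path_term [u == _]eq_sym.
by congr (_%:E); rewrite mulrC -mulrA mulrC -mulrA [X in (_ * X)%R]mulrC.
Qed.

End PartitionFunctions.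

(** * Mixtures of the functions m_u as path sums, and their total mass *)

Section Mixtures.
Variables (K : realType) (E : digraph) (R : set (vertex E)).
Variables (N : edge E -> K) (beta : K).
Hypothesis N0 : forall e, 0 <= N e.

Local Notation wt := (fun e : edge E => N e `^ (- beta)).
Local Notation scale u := (fine (Z_a N beta u) / (1 - fine (Z_s N beta u))).

Let wt0 : forall e, 0 <= wt e.
Proof. exact: wt_ge0. Qed.

Local Open Scope ereal_scope.

Lemma fin_num_Z_a u : Z_a N beta u < +oo -> Z_a N beta u \is a fin_num.
Proof.
by move=> h; rewrite ge0_fin_numE// esum_ge0// => w _; rewrite lee_fin powR_ge0.
Qed.

Lemma arrivals_le_Z_a u v : arrivals wt u v <= Z_a N beta u.
Proof. by rewrite Z_aE//; apply: esum_ge_term => // w; exact: arrivals_ge0. Qed.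

Lemma Z_a_ge1 u : 1 <= Z_a N beta u.
Proof. by rewrite -(arrivals_self wt0 u) arrivals_le_Z_a. Qed.

(** The factor Z_a(u) cancels the normalisation of m_u, and 1 / (1 - Z_s(u)) = P(u,u) turns F(v,u)
    into P(v,u). *)
Lemma scale_m_beta u v (c : K) : beta_regular N beta u ->
  (scale u * c * m_beta N beta u v)%:E = c%:E * visits wt u v.
Proof.
move=> [ua us]; rewrite Z_sE// in us *; rewrite visitsE// /m_beta.
rewrite esum_first_arrivals_from//.
have Ffin : arrivals wt u v \is a fin_num.
  rewrite ge0_fin_numE ?arrivals_ge0//.
  exact: le_lt_trans (arrivals_le_Z_a u v) ua.
have Za0 : (fine (Z_a N beta u) != 0)%R.
  by rewrite gt_eqF// (lt_le_trans ltr01)// -lee_fin fineK ?Z_a_ge1 ?fin_num_Z_a.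
have s0 : (1 - fine (returns wt u) != 0)%R.
  rewrite gt_eqF// subr_gt0 -lte_fin fineK//.
  by rewrite ge0_fin_numE ?returns_ge0// (lt_trans us)// ltry.
rewrite -[in RHS](fineK Ffin) -!EFinM; congr (_%:E).
move: (1 - _)%R s0 (fine (Z_a _ _ _)) Za0 (fine (arrivals _ _ _)) => s s0 z z0 f.
by field; rewrite s0 z0.
Qed.

Lemma esum_visits u : returns wt u < 1 ->
  \esum_(v in setT) visits wt u v =
  ((1 - fine (Z_s N beta u))^-1)%:E * Z_a N beta u.
Proof.
move=> us; rewrite Z_aE// Z_sE// -esumZl//.
- by apply: eq_esum => v _; exact: visitsE.
- rewrite invr_ge0 subr_ge0 -lee_fin fineK ?ltW//.
  by rewrite ge0_fin_numE ?returns_ge0// (lt_trans us)// ltry.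
- by move=> v; exact: arrivals_ge0.
Qed.

Lemma esum_pathsum (d : vertex E -> K) : (forall v, 0 <= d v)%R ->
  \esum_(v in setT) pathsum wt d v =
  \esum_(u in setT) ((d u)%:E * \esum_(v in setT) visits wt u v).
Proof.
move=> d0; have v0 u v : 0 <= visits wt u v by exact: visits_ge0.
under eq_esum do rewrite pathsum_visits//.
rewrite exchange_esum => [|u v]; last by rewrite mule_ge0 ?lee_fin.
by apply: eq_esum => u _; rewrite esumZl.
Qed.

(** Such a u contributes d(u) times the sum of all P(v,u) to a finite total. So P(u,u) is finite,
    whence Z_s(u) < 1, and then the sum equals Z_a(u) / (1 - Z_s(u)), whence Z_a(u) is finite. *)
Lemma beta_regular_of_fin (d : vertex E -> K) u : (forall v, 0 <= d v)%R ->
  \esum_(v in setT) pathsum wt d v < +oo -> (0 < d u)%R -> beta_regular N beta u.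
Proof.
move=> d0 fin du; have v0 v : 0 <= visits wt u v by exact: visits_ge0.
have finu : \esum_(v in setT) visits wt u v < +oo.
  rewrite ltNge leye_eq; apply/eqP => oo.
  move: fin; rewrite esum_pathsum// ltNge => /negP; apply.
  apply: (@le_trans _ _ ((d u)%:E * \esum_(v in setT) visits wt u v)).
    by rewrite oo gt0_muley ?lte_fin.
  apply: (@esum_ge_term _ _ _
    (fun u => (d u)%:E * \esum_(v in setT) visits wt u v)) => // w.
  by rewrite mule_ge0 ?lee_fin ?esum_ge0// => v _; exact: visits_ge0.
have us : returns wt u < 1.
  apply: returns_lt1 => //; apply: le_lt_trans finu.
  exact: (@esum_ge_term _ _ _ (visits wt u)).
split; last by rewrite /= Z_sE.
rewrite /= ltNge leye_eq; apply/eqP => oo; move: finu; rewrite esum_visits// oo.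
rewrite gt0_muley ?ltxx// lte_fin invr_gt0 subr_gt0 Z_sE// -lte_fin fineK//.
by rewrite ge0_fin_numE ?returns_ge0// (lt_trans us)// ltry.
Qed.

Section Supported.
Variable d : vertex E -> K.
Hypothesis d0 : forall v, (0 <= d v)%R.
Hypothesis dA : forall v, ~ (beta_regular N beta `\` R) v -> d v = 0%R.
Local Notation eps :=
  (fun a : (beta_regular N beta `\` R) => (scale (val a) * d (val a))%R).

Lemma mixture_pathsum v : mixture R N beta eps v = pathsum wt d v.
Proof.
rewrite pathsum_visits// /mixture.
rewrite (@esum_set_type _ _ _ (fun u => (scale u * d u * m_beta N beta u v)%:E)).
rewrite -(@esum_support _ _ (beta_regular N beta `\` R) setT)//.
  by apply: eq_esum => u [ur _]; rewrite scale_m_beta.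
by move=> u _ /dA ->; rewrite mul0e.
Qed.

Lemma esum_scale :
  \esum_(a in setT) (eps a)%:E = \esum_(v in setT) pathsum wt d v.
Proof.
rewrite esum_pathsum// (@esum_set_type _ _ _ (fun u => (scale u * d u)%:E)).
rewrite -(@esum_support _ _ (beta_regular N beta `\` R) setT)//.
  apply: eq_esum => u [[/= ua us] _].
  rewrite esum_visits ?Z_sE//; last by rewrite -Z_sE.
  rewrite -[in RHS](fineK (fin_num_Z_a ua)) -!EFinM; congr (_%:E).
  by rewrite mulrC [X in (_ * X)%R]mulrC.
by move=> u _ /dA ->; rewrite mul0e.
Qed.

End Supported.
End Mixtures.

(** * The path space *)

Section BoundaryTopology.
Variables (E : digraph) (R : set (vertex E)).

Lemma open_path_subbase (A : set (path_space E)) : path_subbase A -> open A.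
Proof.
move=> sA; exists [set A] => [B ->|]; last by rewrite bigcup_set1.
exists [fset A]%fset; last by rewrite set_fset1 bigcap_set1.
by move=> C; rewrite !inE => /eqP ->; exact/mem_set.
Qed.

Lemma open_cylinder (u : finpath E) : open (cylinder u).
Proof. by apply: open_path_subbase; exists u; left. Qed.

Lemma open_cylinderC (u : finpath E) : open (~` cylinder u).
Proof. by apply: open_path_subbase; exists u; right. Qed.

Lemma open_val (x0 : boundary R) (A : set (path_space E)) :
  open A -> open ([set x | A (val x)] : set (pboundary x0)).
Proof. by move=> oA; exists A. Qed.

Lemma open_measurable_boundary (x0 : boundary R) (A : set (pboundary x0)) :
  open A -> measurable (A : set (borel_boundary x0)).
Proof. exact: sub_sigma_algebra. Qed.

(** These sets decrease in n, and their intersection is the set of infinite paths. *)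
Definition path_length_ge (n : nat) : set (path_space E) :=
  [set x | if x is inl u then (n <= size (path_edges u))%N else True].

Lemma infpathP (x : infpath E) i : tgt (val x i) = src (val x i.+1).
Proof. by case: x => x h /=; move/asboolP: h; apply. Qed.

Lemma chain_infpath (x : infpath E) i n :
  chain (src (val x i)) (map (val x) (iota i n)).
Proof. by elim: n i => //= n IH i; rewrite eqxx infpathP; exact: IH. Qed.

(** A path of length at least n lies in the cylinder of its first n edges. As there may be
    uncountably many such cylinders, measurability is later drawn from openness rather than from
    this union. *)
Lemma open_path_length_ge n : open (path_length_ge n).
Proof.
have -> : path_length_ge n =
    \bigcup_(w in [set w | size (path_edges w) = n]) cylinder w.
  apply/seteqP; split=> [[[[v l] vl]|x] nx|[[[v l] vl]|x]//].
  - have vln : chain v (take n l).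
      by move: (vl); rewrite /= -{1}(cat_take_drop n l) chain_cat => /andP[].
    exists (exist _ (v, take n l) vln); first by rewrite /path_edges /= size_takel.
    by split=> //; rewrite prefix_take.
  - exists (exist _ (src (val x 0%N), mkseq (val x) n) (chain_infpath x 0 n)).
      by rewrite /path_edges /= size_mkseq.
    by split=> //; rewrite /path_edges /= size_mkseq.
  - by move=> [w /= <- [_ /size_prefix]].
by apply: bigcup_open => w _; exact: open_cylinder.
Qed.

End BoundaryTopology.

(** * Prefixing an edge to a path *)

Section EdgeShift.
Variables (E : digraph) (R : set (vertex E)).
Implicit Types (e : edge E) (x y : path_space E).

Lemma chain_edge e : chain (src e) [:: e].
Proof. by rewrite /= eqxx. Qed.

Definition edge_path e : finpath E := exist _ (src e, [:: e]) (chain_edge e).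

Lemma is_cons_source e x y : is_cons e x y -> cylinder (vpath (tgt e)) x.
Proof.
case: x y => [u|u] [w|w] //=; first by case=> -> _; split; rewrite ?prefix0s.
case=> we wu; split=> //; rewrite -we.
exact: etrans (infpathP w 0) (congr1 _ (wu 0%N)).
Qed.

Lemma is_cons_edge e x y : is_cons e x y -> cylinder (edge_path e) y.
Proof.
case: x y => [u|u] [w|w] //= [h1 h2].
  by case: h2 => -> ->; split; rewrite //= eqxx prefix0s.
by rewrite /mkseq /= h1.
Qed.

Lemma is_cons_length e x y n : is_cons e x y ->
  path_length_ge n.+1 y <-> path_length_ge n x.
Proof. by case: x y => [u|u] [w|w] //= [_ [_ ->]]. Qed.

Lemma path_rng_cons e (u w : finpath E) : is_cons e (inl u) (inl w) ->
  path_rng w = path_rng u.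
Proof. by rewrite /path_rng => -[<- [-> ->]]. Qed.

Lemma is_cons_boundary e x y : is_cons e x y -> boundary R x <-> boundary R y.
Proof.
by case: x y => [u|u] [w|w] // /path_rng_cons uw; rewrite /boundary /= uw.
Qed.

Lemma is_cons_edge_inj e e' x x' y : is_cons e x y -> is_cons e' x' y -> e = e'.
Proof.
case: x x' y => [u|u] [u'|u'] [w|w] //= [].
  by move=> _ [_ ->] [_ [_ []]].
by move=> <- _ [<-].
Qed.

Lemma is_consP e y : cylinder (edge_path e) y -> exists x, is_cons e x y.
Proof.
case: y => [[[v [|f l]] vl]|y] //=; rewrite /path_src /path_edges /=.
- by case.
- move=> [ev /andP[/eqP ef _]]; move: vl; rewrite -{}ef -{f}ev => vl.
  have /= /andP[_ el] := vl.
  by exists (inl (exist _ (tgt e, l) el)).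
- move=> [ey [ey0]].
  have yS : `[< forall i, tgt (val y i.+1) = src (val y i.+2) >].
    by apply/asboolP => i; exact: infpathP.
  by exists (inr (exist _ (fun i => val y i.+1) yS)).
Qed.

(** Exhibits the image under prefixing e as the trace of an open set, hence as a measurable set. *)
Lemma cons_set_length e n :
  cons_set e [set x : boundary R |
    path_length_ge n (val x) /\ cylinder (vpath (tgt e)) (val x)] =
  [set y : boundary R |
    path_length_ge n.+1 (val y) /\ cylinder (edge_path e) (val y)].
Proof.
apply/seteqP; split=> [y [x [nx ex] xy]|y [/= ny /is_consP[x xy]]].
  by split; [apply/(is_cons_length n xy)|exact: is_cons_edge xy].
have Rx : boundary R x by apply/(is_cons_boundary xy); exact: set_valP.
exists (SigSub (mem_set Rx)) => //=.
by split; [apply/(is_cons_length n xy)|exact: is_cons_source xy].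
Qed.

Lemma trivIset_cons_set (D : set (edge E)) (A : edge E -> set (boundary R)) :
  trivIset D (fun e => cons_set e (A e)).
Proof.
move=> e e' _ _ [y [[x _ xy] [x' _ x'y]]].
exact: is_cons_edge_inj xy x'y.
Qed.

End EdgeShift.

(** * From finite type to mixtures *)

Section FiniteType.
Variables (K : realType) (E : digraph) (R : set (vertex E)).
Variables (N : edge E -> K) (beta : K) (m : vertex E -> K).
Variables (x0 : boundary R) (mu : probability (borel_boundary x0) K).
Hypothesis mD : D_beta R N beta m.
Hypothesis mum : associated_measure N beta m mu.

Local Notation wt := (fun e : edge E => N e `^ (- beta)).

Let wt0 : forall e, 0 <= wt e.
Proof. by move=> e; exact: powR_ge0. Qed.

Let m0 v : 0 <= m v.
Proof. by have [/(_ v)/andP[]] := mD. Qed.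

(** For m in D^beta the sum over edges is at most m(v), so [fine] is exact here. *)
Definition defect v : K := m v - fine (out_sum N beta m v).

Local Open Scope ereal_scope.

Lemma out_sum_fin_num v : out_sum N beta m v \is a fin_num.
Proof.
have [_ _ _ /(_ v) le_m] := mD.
rewrite ge0_fin_numE ?(le_lt_trans le_m) ?ltry// esum_ge0// => e _.
by rewrite lee_fin mulr_ge0.
Qed.

Lemma defect_ge0 v : (0 <= defect v)%R.
Proof.
by have [_ _ _ /(_ v)] := mD; rewrite subr_ge0 -lee_fin fineK ?out_sum_fin_num.
Qed.

Lemma defect0 v : R v -> defect v = 0%R.
Proof.
by have [_ _ mR _] := mD => /mR; rewrite /defect => <- /=; rewrite subrr.
Qed.

Lemma defectE v : (m v)%:E =
  (defect v)%:E + \esum_(e in out v) ((wt e)%:E * (m (tgt e))%:E).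
Proof.
have -> : \esum_(e in out v) ((wt e)%:E * (m (tgt e))%:E) = out_sum N beta m v.
  by apply: eq_esum => e _; rewrite -EFinM.
by rewrite -[X in _ + X]fineK ?out_sum_fin_num// -EFinD subrK.
Qed.

(** By [defectE], m itself solves the recursion of which the path sum is the least solution. *)
Lemma pathsum_defect_le v : pathsum wt defect v <= (m v)%:E.
Proof.
apply: (@pathsum_le _ _ _ _ wt0 defect_ge0 (fun v => (m v)%:E)) => w.
  by rewrite lee_fin.
by rewrite -defectE.
Qed.

Definition long_paths n v : set (borel_boundary x0) :=
  [set x : boundary R | path_length_ge n (val x) /\ cylinder (vpath v) (val x)].

Lemma measurable_path_set (A : set (path_space E)) : open A ->
  measurable ([set x : boundary R | A (val x)] : set (borel_boundary x0)).
Proof. by move=> oA; apply: open_measurable_boundary; exact: open_val. Qed.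

Lemma measurable_long_paths n v : measurable (long_paths n v).
Proof.
apply: (@measurable_path_set (path_length_ge n `&` cylinder (vpath v))).
by apply: openI; [exact: open_path_length_ge|exact: open_cylinder].
Qed.

Lemma measurable_cons_long_paths n e :
  measurable (cons_set e (long_paths n (tgt e)) : set (borel_boundary x0)).
Proof.
rewrite /long_paths cons_set_length.
apply: (@measurable_path_set (path_length_ge n.+1 `&` cylinder (edge_path e))).
by apply: openI; [exact: open_path_length_ge|exact: open_cylinder].
Qed.

(** Prefixing distinct edges out of v gives disjoint sets of longer paths from v, whose measures are
    the summands by the scaling property. Only finite partial sums are compared, so v may emit
    uncountably many edges. *)
Lemma esum_long_paths_le n v :
  \esum_(e in out v) ((wt e)%:E * mu (long_paths n (tgt e))) <=
  mu (long_paths n.+1 v).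
Proof.
apply: ge_ereal_sup => _ [X [finX Xv] <-].
have [_ _ scaling] := mum.
pose F e : set (borel_boundary x0) := cons_set e (long_paths n (tgt e)).
have mF e : measurable (F e) by exact: measurable_cons_long_paths.
rewrite (eq_fsbigr (mu \o F)) => [|e _]; last first.
  by rewrite /= scaling//; [exact: measurable_long_paths|move=> x []].
rewrite -(@measure_fin_bigcup _ _ _ mu _ X F)//; last exact: trivIset_cons_set.
apply: le_measure.
- by apply/mem_set/fin_bigcup_measurable.
- by apply: mem_set; exact: measurable_long_paths.
- move=> y [e /Xv/= ev]; rewrite /F /long_paths cons_set_length => -[ny ey].
  split=> //; case: (val y) ey => [w|w] /= [ew _].
    by split; rewrite -?ew -?ev ?prefix0s.
  by split=> //; rewrite -ew -ev.
Qed.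

(** The bound at each r(e) is inserted into m(v) = d(v) + sum of N(e)^{-beta} m(r(e)); the path sums
    recombine by their recursion, and the error terms by [esum_long_paths_le]. *)
Lemma le_pathsum_defect n v :
  (m v)%:E <= pathsum wt defect v + mu (long_paths n v).
Proof.
elim: n v => [|n IH] v.
  have [_ muv _] := mum; rewrite -muv.
  rewrite [X in mu X](_ : _ = long_paths 0 v); last first.
    apply/seteqP; split=> x /=; last by case.
    by move=> vx; split=> //; rewrite /path_length_ge /=; case: (val x).
  by rewrite leeDr// pathsum_ge0// => w; exact: defect_ge0.
rewrite pathsum_rec//; last exact: defect_ge0.
rewrite defectE -addeA leeD2l//.
apply: (@le_trans _ _ (\esum_(e in out v) ((wt e)%:E * pathsum wt defect (tgt e)
    + (wt e)%:E * mu (long_paths n (tgt e))))).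
  apply: le_esum => e _; rewrite -ge0_muleDr ?pathsum_ge0//; last exact: defect_ge0.
  by rewrite lee_pmul// lee_fin.
rewrite esumD => [|e _|e _].
- by rewrite leeD2l// esum_long_paths_le.
- by rewrite mule_ge0 ?lee_fin// pathsum_ge0// => w; exact: defect_ge0.
- by rewrite mule_ge0 ?lee_fin.
Qed.

Lemma mu_long_paths_cvg v : mu (finite_paths R) = 1 ->
  (fun n => mu (long_paths n v)) @ \oo --> 0.
Proof.
move=> mu1.
pose L n : set (borel_boundary x0) :=
  [set x : boundary R | path_length_ge n (val x)].
have mL n : measurable (L n).
  by apply: measurable_path_set; exact: open_path_length_ge.
have LC : \bigcap_n L n = ~` finite_paths R.
  apply/seteqP; split=> [x xL [u xu]|x xinf n _].
    have := xL (size (path_edges u)).+1 I.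
    by rewrite /L /= xu /= ltnn.
  by rewrite /L /=; case xu : (val x) => [u|//]; case: xinf; exists u.
have muL : mu (\bigcap_n L n) = 0.
  (* There may be uncountably many finite paths; their set is measurable because its complement is a
     countable intersection of open sets. *)
  have mfin : measurable (finite_paths R : set (borel_boundary x0)).
    by rewrite -[finite_paths R]setCK -LC; apply/measurableC/bigcapT_measurable.
  by rewrite LC probability_setC// mu1 subee.
apply: (@squeeze_cvge _ _ _ _ (cst 0) _ (mu \o L)).
- apply: nearW => n /=; rewrite measure_ge0/= le_measure ?mem_set//.
    exact: measurable_long_paths.
  by move=> x [].
- exact: cvg_cst.
- rewrite -muL; apply: nonincreasing_cvg_mu => //.
  + by rewrite (le_lt_trans (probability_le1 _ _))// ltry.
  + exact: bigcapT_measurable.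
  + move=> i j ij; apply/subsetPset => x; rewrite /L /=.
    by case: (val x) => // u; exact: leq_trans.
Qed.

Lemma pathsum_defect v : mu (finite_paths R) = 1 ->
  pathsum wt defect v = (m v)%:E.
Proof.
move=> /(mu_long_paths_cvg v) mu_cvg.
apply/eqP; rewrite eq_le pathsum_defect_le /=.
have cvgD : (fun n => pathsum wt defect v + mu (long_paths n v)) @ \oo -->
    pathsum wt defect v + 0.
  by apply: cvgeD mu_cvg; [rewrite fin_num_adde_defl|exact: cvg_cst].
rewrite -[leRHS]adde0; apply: (cvge_to_ge cvgD).
by apply: nearW => n; exact: le_pathsum_defect.
Qed.

End FiniteType.

(** * From mixtures to finite type *)

Section PathMeasure.
Variables (K : realType) (E : digraph) (R : set (vertex E)).
Variables (N : edge E -> K) (beta : K) (d : vertex E -> K).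

Local Notation wt := (fun e : edge E => N e `^ (- beta)).

Hypothesis d0 : forall v, 0 <= d v.
Hypothesis dR : forall v, R v -> d v = 0.
Hypothesis d1 : \esum_(v in setT) pathsum wt d v = 1%E.

Let wt0 : forall e, 0 <= wt e.
Proof. by move=> e; exact: powR_ge0. Qed.

Local Open Scope ereal_scope.

Definition path_mass (w : finpath E) : \bar K :=
  (path_term wt d (path_src w) (path_edges w))%:E.

Definition path_trace (A : set (boundary R)) : set (finpath E) :=
  [set w | exists2 x, A x & val x = inl w].

Lemma path_mass_ge0 w : 0 <= path_mass w.
Proof. by rewrite lee_fin path_term_ge0. Qed.

(** The finite paths missing from the boundary are those that end in R. Since they carry no mass,
    sums over traces may be extended to them. *)
Lemma path_mass0 w : R (path_rng w) -> path_mass w = 0.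
Proof. by move=> /dR wR; rewrite /path_mass /path_term wR mulr0. Qed.

Lemma esum_path_mass_from v :
  \esum_(w in [set w | path_src w = v]) path_mass w = pathsum wt d v.
Proof.
transitivity (\esum_(w in [set w | path_src w = v])
    (path_term wt d v (path_edges w))%:E).
  by apply: eq_esum => w /= <-.
rewrite (@esum_paths_from _ _ v _ predT (fun l => (path_term wt d v l)%:E))//.
by move=> w; split=> [|[]].
Qed.

Lemma esum_path_massT : \esum_(w in setT) path_mass w = 1.
Proof.
rewrite (@esum_fibres _ _ _ _ (@path_src E))//; last exact: path_mass_ge0.
rewrite -d1; apply: eq_esum => v _; rewrite -esum_path_mass_from.
by congr esum; rewrite setTI.
Qed.

Lemma finpath_ext (u w : finpath E) :
  path_src u = path_src w -> path_edges u = path_edges w -> u = w.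
Proof.
move: u w => [[v l] vl] [[v' l'] vl']; rewrite /path_src /path_edges /= => vv' ll'.
by apply: val_inj; rewrite /= vv' ll'.
Qed.

Lemma path_trace_sub A B : A `<=` B -> path_trace A `<=` path_trace B.
Proof. by move=> AB w [x Ax xw]; exists x => //; exact: AB. Qed.

Lemma path_traceP (w : finpath E) (A : set (path_space E)) :
  path_trace [set x | A (val x)] w <-> ~ R (path_rng w) /\ A (inl w).
Proof.
split=> [[x Ax xw]|[wR Aw]].
  have Rx : boundary R (val x) by exact: set_valP.
  by rewrite xw in Rx; split; rewrite // -xw.
by exists (SigSub (mem_set (wR : boundary R (inl w)))).
Qed.

Section Measure.
Variable x0 : boundary R.

Definition path_measure (A : set (borel_boundary x0)) : \bar K :=
  \esum_(w in path_trace A) path_mass w.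

Let path_measure0 : path_measure set0 = 0.
Proof.
rewrite /path_measure (_ : path_trace set0 = set0) ?esum_set0//.
by apply/seteqP; split=> // w [].
Qed.

Let path_measure_ge0 A : 0 <= path_measure A.
Proof. by apply: esum_ge0 => w _; exact: path_mass_ge0. Qed.

Let path_measure_sigma_additive : semi_sigma_additive path_measure.
Proof.
move=> F mF tF mUF.
have -> : path_measure (\bigcup_n F n) = \sum_(0 <= i <oo) path_measure (F i).
  rewrite /path_measure -nneseries_sum_bigcup//; last exact: path_mass_ge0.
    congr esum; apply/seteqP; split=> [w [x [n _ Fx] xw]|w [n _ [x Fx xw]]].
      by exists n => //; exists x.
    by exists x => //; exists n.
  move=> i j _ _ [w [[x Fx xw] [y Fy yw]]]; apply: tF => //.
  by exists x; split=> //; rewrite (_ : x = y)//; apply: val_inj; rewrite xw.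
by apply: is_cvg_nneseries => n _ _; exact: path_measure_ge0.
Qed.

HB.instance Definition _ := isMeasure.Build _ _ _ path_measure
  path_measure0 path_measure_ge0 path_measure_sigma_additive.

Let path_measure_setT : path_measure setT = 1.
Proof.
rewrite -esum_path_massT; apply: esum_support => // w _ wR.
apply: path_mass0; apply: contrapT => nR; apply: wR.
by have /path_traceP : ~ R (path_rng w) /\ [set: path_space E] (inl w) by [].
Qed.

HB.instance Definition _ := Measure_isProbability.Build _ _ _ path_measure
  path_measure_setT.

Lemma path_measure_finite_paths : path_measure (finite_paths R) = 1.
Proof.
rewrite -path_measure_setT; congr esum; apply/seteqP.
split; first exact: path_trace_sub.
by move=> w [x _ xw]; exists x => //; exists w.
Qed.

Lemma path_measure_cylinder v :
  path_measure (bcylinder R (vpath v)) = pathsum wt d v.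
Proof.
rewrite -esum_path_mass_from; apply: esum_support => w /=.
  by move=> /path_traceP[_ [<-]].
move=> wv wR; apply: path_mass0; apply: contrapT => nR; apply: wR.
by apply/path_traceP; split=> //; split; rewrite ?prefix0s.
Qed.

(** Prefixing e is a bijection from the finite paths in A to those in eA, and it multiplies each
    mass by N(e)^{-beta}. *)
Lemma path_measure_cons e (A : set (borel_boundary x0)) :
  A `<=` bcylinder R (vpath (tgt e)) ->
  path_measure (cons_set e A) = (wt e)%:E * path_measure A.
Proof.
move=> Ae; have A_src w : path_trace A w -> path_src w = tgt e.
  move=> [x Ax xw]; have := Ae x Ax.
  by rewrite /bcylinder /mkset /cylinder /mkset xw => -[<-].
(* The default value of [insubd] is never taken when w starts at r(e), the only case used. *)
pose cons (w : finpath E) : finpath E :=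
  insubd (vpath (src e)) (src e, e :: path_edges w).
have consE w : path_src w = tgt e -> is_cons e (inl w) (inl (cons w)).
  case: w => [[v l] vl]; rewrite /path_src /= => ve; subst v.
  by rewrite /= /path_src /path_edges /cons val_insubd /= eqxx vl.
rewrite /path_measure (@reindex_esum _ _ _ (path_trace A) _ cons).
  rewrite -esumZl//; last exact: path_mass_ge0.
  apply: eq_esum => w /A_src we; rewrite /path_mass.
  have [_ [-> ->]] := consE _ we.
  by rewrite path_term_cons EFinM we.
split=> [w Aw|u w /set_mem/A_src ue /set_mem/A_src we uw|w [y [x Ax xy] yw]].
- have we := consE _ (A_src _ Aw); have [x Ax xw] := Aw.
  have Rw : boundary R (inl (cons w)).
    by apply/(is_cons_boundary R we); rewrite -xw; exact: set_valP.
  by exists (SigSub (mem_set Rw)) => //; exists x => //; rewrite xw.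
- have [_ [_]] := consE _ ue; have [_ [_]] := consE _ we; rewrite uw => -> [uw'].
  by apply: finpath_ext; rewrite ?ue ?we.
- move: xy; rewrite yw; case xu : (val x) => [u|//] uw.
  have Au : path_trace A u by exists x.
  exists u => //; have [_ [s1 l1]] := consE _ (A_src _ Au).
  by have [_ [s2 l2]] := uw; apply: finpath_ext; rewrite ?s1 ?s2 ?l1 ?l2.
Qed.

(** Finite paths are closed points: a path other than w either lies outside the cylinder of w or is
    strictly longer than w. *)
Lemma open_neq_path (w : finpath E) :
  open ([set x : boundary R | val x <> inl w] : set (pboundary x0)).
Proof.
apply: (@open_val _ _ _ [set x | x <> inl w]).
rewrite (_ : [set x | _] =
    ~` cylinder w `|` path_length_ge (size (path_edges w)).+1); last first.
  apply/seteqP; split=> [x xw|x].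
    have [wx|] := pselect (cylinder w x); last by left.
    right; case: x xw wx => [u|//] uw [su /prefixP[l ul]].
    rewrite /path_length_ge /= ul size_cat -addn1 leq_add2l lt0n size_eq0.
    apply/eqP => l0; apply: uw; congr inl; apply: finpath_ext => //.
    by rewrite ul l0 cats0.
  move=> [wx|+] xw; last by rewrite xw /path_length_ge /= ltnn.
  by apply: wx; rewrite xw; split; rewrite ?prefix_refl.
by apply: openU; [exact: open_cylinderC|exact: open_path_length_ge].
Qed.

Let outer_regular (A : set (borel_boundary x0)) :
  path_measure A = ereal_inf [set path_measure U | U in
    [set U : set (pboundary x0) | open U /\ A `<=` U]].
Proof.
have mono (B C : set (boundary R)) : B `<=` C ->
  \esum_(w in path_trace B) path_mass w <= \esum_(w in path_trace C) path_mass w.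
  move=> /path_trace_sub BC; apply: esum_subset => //; exact: path_mass_ge0.
apply/eqP; rewrite eq_le; apply/andP; split.
  by apply: le_ereal_inf_tmp => _ [U [_ AU] <-]; exact: mono.
have split1 S : \esum_(w in S) path_mass w + \esum_(w in ~` S) path_mass w = 1.
  rewrite -esum_path_massT (@esumID _ _ S [set: finpath E]) ?setTI//.
  by move=> w _; exact: path_mass_ge0.
have fin S : \esum_(w in S) path_mass w \is a fin_num.
  rewrite ge0_fin_numE; last by apply: esum_ge0 => w _; exact: path_mass_ge0.
  rewrite (@le_lt_trans _ _ 1) ?ltry// -(split1 S) leeDl//.
  by apply: esum_ge0 => w _; exact: path_mass_ge0.
apply/lee_addgt0Pr => eps eps0.
(* A finite set X carries all but eps of the mass outside A; the complement of
   X is an open neighbourhood of A. *)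
have [_ [X [finX XA] <-] Xeps] :=
  ub_ereal_sup_adherent eps0 (fin (~` path_trace A)).
rewrite -/(esum (~` path_trace A) path_mass) -esum_fset// in Xeps; last first.
  by move=> w _; exact: path_mass_ge0.
pose U : set (pboundary x0) :=
  ~` \bigcup_(w in X) [set x : boundary R | val x = inl w].
apply: (@le_trans _ _ (path_measure U)).
  apply: ereal_inf_lbound; exists U => //; split.
    apply: closed_openC; apply: closed_bigcup => // w _.
    by rewrite -openC; exact: open_neq_path.
  by move=> x Ax [w Xw xw]; apply: (XA w Xw); exists x.
apply: (@le_trans _ _ (\esum_(w in ~` X) path_mass w)).
  apply: esum_subset; first exact: path_mass_ge0.
  by move=> w [x Ux xw] Xw; apply: Ux; exists w.
(* With x, y, a, c the masses of X, its complement, A and its complement: y = 1 - x < 1 - c + eps =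
   a + eps. *)
move: (split1 X) (split1 (path_trace A)) Xeps (fin X) (fin (~` X)).
move: (fin (path_trace A)) (fin (~` path_trace A)); rewrite /path_measure.
move: (esum X _) (esum (~` X) _) (esum (path_trace A) _).
move: (esum (~` path_trace A) _) => [c| |] [x| |] [y| |] [a| |]//.
rewrite -EFinB -!EFinD lte_fin lee_fin => [_ _ [xy] [ac] cx _ _].
lra.
Qed.

(** The mass of U is a supremum over finite sets of finite paths in U, and finite sets are
    compact. *)
Let inner_regular (U : set (pboundary x0)) : open U ->
  path_measure U = ereal_sup [set path_measure C | C in
    [set C : set (pboundary x0) | compact C /\ C `<=` U]].
Proof.
move=> oU; apply/eqP; rewrite eq_le; apply/andP; split; last first.
  apply: ge_ereal_sup => _ [C [_ CU] <-].
  by apply: esum_subset; [exact: path_mass_ge0|exact: path_trace_sub].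
apply: ge_ereal_sup => _ [X [finX XU] <-].
pose C : set (pboundary x0) :=
  [set x : boundary R | exists2 w, X w & val x = inl w].
have finC : finite_set C.
  apply: (@sub_finite_set _ _ ((@set_val _ (boundary R)) @^-1` (inl @` X))).
    by move=> x [w Xw xw]; exists w.
  apply: finite_preimage; last exact: finite_image.
  by move=> x y _ _ /val_inj.
apply: ereal_sup_ubound; exists C.
  split; first exact: finite_compact.
  move=> x [w /XU [y Uy yw] xw].
  by rewrite (_ : x = y)//; apply: val_inj; rewrite xw yw.
rewrite /path_measure (_ : path_trace C = X).
  by rewrite esum_fset// => w _; exact: path_mass_ge0.
apply/seteqP; split=> [w [x [w' Xw' xw'] xw]|w Xw].
  by move: xw; rewrite xw' => -[<-].
by have [x Ux xw] := XU _ Xw; exists x => //; exists w.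
Qed.

Lemma exists_associated_measure (m : vertex E -> K) :
  (forall v, pathsum wt d v = (m v)%:E) ->
  exists mu : probability (borel_boundary x0) K,
    associated_measure N beta m mu /\ mu (finite_paths R) = 1.
Proof.
move=> md; exists path_measure; split; last exact: path_measure_finite_paths.
split=> [|v|e A _ Ae].
- by split=> [A _|U]; [exact: outer_regular|exact: inner_regular].
- by rewrite -md; exact: path_measure_cylinder.
- exact: path_measure_cons.
Qed.

End Measure.
End PathMeasure.

(** * The two inverse maps between functions of finite type and the simplex *)

Section FiniteTypeSimplex.
Variables (K : realType) (E : digraph) (R : set (vertex E)).
Variables (N : edge E -> K) (beta : K).
Hypothesis N0 : forall e, 0 <= N e.

Local Notation wt := (fun e : edge E => N e `^ (- beta)).
Local Notation scale u := (fine (Z_a N beta u) / (1 - fine (Z_s N beta u))).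
Local Notation A := (beta_regular N beta `\` R).
Implicit Types (m : vertex E -> K) (eps : A -> K).

Let wt0 : forall e, 0 <= wt e.
Proof. by move=> e; exact: powR_ge0. Qed.

Lemma beta_regular_gt0 u : beta_regular N beta u ->
  0 < fine (Z_a N beta u) /\ 0 < 1 - fine (Z_s N beta u).
Proof.
move=> [ua us]; split.
  by rewrite (lt_le_trans ltr01)// -lee_fin fineK ?Z_a_ge1 ?fin_num_Z_a.
rewrite subr_gt0 -lte_fin fineK//.
by rewrite ge0_fin_numE ?Z_sE ?returns_ge0// -Z_sE// (lt_trans us)// ltry.
Qed.

(** Dividing by the positive scale and extending by 0 off the index set brings eps into the form
    that the results on mixtures require. *)
Lemma simplex_defect eps : simplex R N beta eps -> exists d : vertex E -> K,
  [/\ forall v, 0 <= d v, forall v, ~ A v -> d v = 0 &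
      eps = fun a => scale (val a) * d (val a)].
Proof.
move=> [eps01 _].
exists (fun u => oapp (fun a : A => (scale (val a))^-1 * eps a) 0 (insub u)).
have A_gt0 (a : A) := beta_regular_gt0 (set_valP a).1.
split=> [v|v Av|].
- case: insubP => //= a _ _; have [a0 s0] := A_gt0 a.
  apply: mulr_ge0; last by have /andP[] := eps01 a.
  by rewrite invr_ge0 ltW// divr_gt0.
- by case: insubP => //= a /set_mem.
- apply/funext => a; rewrite valK /= mulVKf//; have [a0 s0] := A_gt0 a.
  by rewrite gt_eqF ?divr_gt0.
Qed.

Local Open Scope ereal_scope.

(** The mixture is the path sum G of d. The recursion of G shows that d is its defect, which gives
    both the conditions of D^beta and the value of [W_fin]; the point masses on finite paths give
    the measure. *)
Lemma mixture_D_fin eps : simplex R N beta eps ->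
  [/\ forall v, mixture R N beta eps v \is a fin_num,
      D_fin R N beta (fun v => fine (mixture R N beta eps v)) &
      W_fin R N beta (fun v => fine (mixture R N beta eps v)) = eps].
Proof.
move=> seps; have [_ eps1] := seps.
have [d [d0 dA epsE]] := simplex_defect seps.
have mixE v : mixture R N beta eps v = pathsum wt d v.
  by rewrite epsE; exact: mixture_pathsum.
have d1 : \esum_(v in setT) pathsum wt d v = 1.
  by rewrite -(esum_scale N0 d0 dA) -eps1 epsE.
have G0 v : 0 <= pathsum wt d v by exact: pathsum_ge0.
have G1 v : pathsum wt d v <= 1 by rewrite -d1; exact: esum_ge_term.
have Gfin v : pathsum wt d v \is a fin_num.
  by rewrite ge0_fin_numE// (le_lt_trans (G1 v))// ltry.
have -> : mixture R N beta eps = pathsum wt d by exact/funext.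
pose m v := fine (pathsum wt d v).
have mE v : pathsum wt d v = (m v)%:E by rewrite fineK.
have outE v : (m v)%:E = (d v)%:E + out_sum N beta m v.
  rewrite -mE pathsum_rec//; congr (_ + _).
  by apply: eq_esum => e _; rewrite EFinM -mE.
have out_fin v : out_sum N beta m v \is a fin_num.
  rewrite ge0_fin_numE.
    by apply: (@le_lt_trans _ _ (m v)%:E); rewrite ?ltry// outE leeDr// lee_fin.
  by apply: esum_ge0 => e _; rewrite lee_fin mulr_ge0// fine_ge0.
have dE v : d v = (m v - fine (out_sum N beta m v))%R.
  by apply: EFin_inj; rewrite EFinB (fineK (out_fin v)) outE addeK.
have dR v : R v -> d v = 0%R by move=> Rv; apply: dA => -[].
split=> //.
- split.
    split=> [v||v /dR dv|v].
    + by rewrite -!lee_fin fineK// G0 G1.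
    + by rewrite -d1; apply: eq_esum => v _; rewrite fineK.
    + by rewrite outE dv add0e.
    + by rewrite outE leeDr// lee_fin.
  (* The boundary needs a point: as eps sums to 1, its index set contains a vertex, which lies
     outside R and so is a boundary path of length 0. *)
  have [[a _]|noA] := pselect (exists a : A, True); last first.
    move: eps1; rewrite esum1 => [/esym/eqP|a _]; first by rewrite onee_eq0.
    by case: noA; exists a.
  have [_ Ra] := set_valP a.
  pose x0 : boundary R := SigSub (mem_set (Ra : boundary R (inl (vpath (val a))))).
  by exists x0; apply: exists_associated_measure mE.
- by apply/funext => a; rewrite epsE dE.
Qed.

(** By definition [W_fin] scales the defect of m, and the path sum of this defect is m. Mixture and
    total mass are then those of a path sum. *)
Lemma D_fin_simplex m : D_fin R N beta m ->
  simplex R N beta (W_fin R N beta m) /\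
  forall v, mixture R N beta (W_fin R N beta m) v = (m v)%:E.
Proof.
move=> [mD [x0 [mu [mum mu1]]]].
have d0 := defect_ge0 mD.
have mE v := pathsum_defect mD mum v mu1.
have d1 : \esum_(v in setT) pathsum wt (defect N beta m) v = 1.
  by have [_ <- _ _] := mD; apply: eq_esum => v _; exact: mE.
(* On R the defect vanishes by the equality in D^beta; elsewhere a positive defect would force
   beta-regularity, as the total mass is finite. *)
have dA v : ~ A v -> defect N beta m v = 0%R.
  move=> Av; have [/(defect0 mD)//|Rv] := pselect (R v).
  apply/eqP; rewrite eq_le d0 andbT leNgt; apply/negP => dv; apply: Av.
  by split=> //; apply: (beta_regular_of_fin N0 d0) dv; rewrite d1 ltry.
have eps0 (a : A) : (0 <= W_fin R N beta m a)%R.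
  have [a0 s0] := beta_regular_gt0 (set_valP a).1.
  by rewrite mulr_ge0 ?d0// divr_ge0 ?ltW.
have eps1 : \esum_(a in [set: A]) (W_fin R N beta m a)%:E = 1.
  by rewrite -d1 -(esum_scale N0 d0 dA).
split=> [|v]; last by rewrite -mE -(mixture_pathsum N0 d0 dA).
split=> // a; rewrite eps0/= -lee_fin -eps1.
exact: (@esum_ge_term _ _ _ (fun a : A => (W_fin R N beta m a)%:E)).
Qed.

Lemma esum_convex_comb (T : choiceType) (S : set T) (t : K) (f g : T -> K) :
  (0 <= t <= 1)%R -> (forall x, 0 <= f x)%R -> (forall x, 0 <= g x)%R ->
  \esum_(x in S) (convex_comb t f g x)%:E =
  t%:E * (\esum_(x in S) (f x)%:E) + (1 - t)%:E * (\esum_(x in S) (g x)%:E).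
Proof.
move=> /andP[t0 t1] f0 g0; have s0 : (0 <= 1 - t)%R by rewrite subr_ge0.
rewrite -!esumZl// -esumD => [|x _|x _].
- by apply: eq_esum => x _; rewrite -!EFinM -EFinD.
- by rewrite -EFinM lee_fin mulr_ge0.
- by rewrite -EFinM lee_fin mulr_ge0.
Qed.

Lemma simplex_convex t eps1 eps2 : (0 <= t <= 1)%R ->
  simplex R N beta eps1 -> simplex R N beta eps2 ->
  simplex R N beta (convex_comb t eps1 eps2).
Proof.
move=> t01 [e1 s1] [e2 s2].
have p1 a : (0 <= eps1 a)%R by have /andP[] := e1 a.
have p2 a : (0 <= eps2 a)%R by have /andP[] := e2 a.
have /andP[t0 t1] := t01.
have s : \esum_(a in [set: A]) (convex_comb t eps1 eps2 a)%:E = 1.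
  by rewrite esum_convex_comb// s1 s2 !mule1 -EFinD addrC subrK.
have p a : (0 <= convex_comb t eps1 eps2 a)%R.
  by rewrite addr_ge0 ?mulr_ge0// subr_ge0.
split=> // a; rewrite p/= -lee_fin -s.
exact: (@esum_ge_term _ _ _ (fun a : A => (convex_comb t eps1 eps2 a)%:E)).
Qed.

Lemma m_beta_ge0 u v : (0 <= m_beta N beta u v)%R.
Proof.
rewrite mulr_ge0 ?invr_ge0 ?fine_ge0// esum_ge0// => w _;
  by rewrite lee_fin powR_ge0.
Qed.

Lemma mixture_convex_comb t eps1 eps2 v : (0 <= t <= 1)%R ->
  (forall a, 0 <= eps1 a)%R -> (forall a, 0 <= eps2 a)%R ->
  mixture R N beta (convex_comb t eps1 eps2) v =
  t%:E * mixture R N beta eps1 v + (1 - t)%:E * mixture R N beta eps2 v.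
Proof.
move=> t01 p1 p2; rewrite /mixture -esum_convex_comb//.
- by apply: eq_esum => a _; rewrite /convex_comb mulrDl !mulrA.
- by move=> a; rewrite mulr_ge0 ?m_beta_ge0.
- by move=> a; rewrite mulr_ge0 ?m_beta_ge0.
Qed.

End FiniteTypeSimplex.

Theorem theorem5p6 (K : realType) (E : digraph) (R : set (vertex E))
    (hR : R `<=` @regular_vertices E)
    (N : edge E -> K) (hN : forall e, 1 < N e)
    (beta : K) (hbeta : 0 <= beta) :
  convex_isomorphism (D_fin R N beta) (simplex R N beta)
    (W_fin R N beta) /\
  (forall eps, simplex R N beta eps ->
    (forall v', mixture R N beta eps v' \is a fin_num) /\
    D_fin R N beta (fun v' => fine (mixture R N beta eps v')) /\
    W_fin R N beta (fun v' => fine (mixture R N beta eps v')) = eps) /\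
  (forall m, D_fin R N beta m ->
    forall v', mixture R N beta (W_fin R N beta m) v' = (m v')%:E).
Proof.
have N0 e : 0 <= N e by rewrite ltW// (lt_trans ltr01).
split; last first.
  by split=> [eps /(mixture_D_fin N0)[]|m /(D_fin_simplex N0)[]].
split.
  split=> [m /(D_fin_simplex N0)[]//|m1 m2 /set_mem m1D /set_mem m2D W12|eps].
    (* Injectivity: m is recovered as the mixture of its image. *)
    have [_ mix1] := D_fin_simplex N0 m1D; have [_ mix2] := D_fin_simplex N0 m2D.
    by apply/funext => v; apply: EFin_inj; rewrite -mix1 -mix2 W12.
  by move=> /(mixture_D_fin N0)[_ De We]; eexists; [exact: De|exact: We].
(* Convexity is obtained through the inverse, without combining measures: mixtures are affine in
   eps, so the combination of f and g is the mixture of the combined images. *)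
move=> t f g t01 fD gD.
have [fs mf] := D_fin_simplex N0 fD; have [gs mg] := D_fin_simplex N0 gD.
have [_ De We] := mixture_D_fin N0 (simplex_convex t01 fs gs).
have mixE : (fun v => fine (mixture R N beta
    (convex_comb t (W_fin R N beta f) (W_fin R N beta g)) v)) = convex_comb t f g.
  apply/funext => v; rewrite mixture_convex_comb ?mf ?mg//.
  - by move=> a; have [/(_ a)/andP[]] := fs.
  - by move=> a; have [/(_ a)/andP[]] := gs.
by rewrite mixE in De We.
Qed.
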